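(* Let $a$ and $b$ be non-negative integers. Then $S_1(a,b)=\binom{a+b+1}{a}-1$.
   Context: For a positive integer $n$, write $[n]=\{1,\dots,n\}$. A skew Bollob\'{a}s system is a finite collection $\mathcal{P}=\{(A_i,B_i):1\leq i\leq m\}$ of pairs of subsets of $[n]$ (for some positive integer $n$) such that $A_i\cap B_i=\emptyset$ for all $i\in[m]$ and $A_i\cap B_j\neq\emptyset$ for all $1\leq i<j\leq m$. Define $S_1(a,b)$ to be the maximum of $\left|\bigcup_{i=1}^m A_i\right|$ over all skew Bollob\'{a}s systems $\{(A_i,B_i):1\leq i\leq m\}$ (over all $n$ and $m$) satisfying $|A_i|\leq a$ and $|B_i|\leq b$ for all $i\in[m]$. *)

(* Defs.v *)
From mathcomp Require Import all_boot.

Set Implicit Arguments.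
Unset Strict Implicit.
Unset Printing Implicit Defensive.

(* The ground set [n] = {1, ..., n} is rendered by 'I_n = {0, ..., n - 1}, and
   the m pairs are indexed by 'I_m.  The two conditions force the pairs to be
   pairwise distinct, so indexed families and collections of pairs agree. *)
Definition skew_bollobas (n m : nat) (A B : 'I_m -> {set 'I_n}) : Prop :=
  (forall i : 'I_m, A i :&: B i = set0) /\
  (forall i j : 'I_m, i < j -> A i :&: B j <> set0).

Definition union_size (a b k : nat) : Prop :=
  exists (n m : nat) (A B : 'I_m -> {set 'I_n}),
    [/\ 0 < n,
        skew_bollobas A B,
        forall i : 'I_m, #|A i| <= a /\ #|B i| <= b &
        k = #|\bigcup_(i < m) A i| ].

Definition is_maximum (P : nat -> Prop) (s : nat) : Prop :=
  P s /\ forall k : nat, P k -> k <= s.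

(* [is_S1 a b s] reads "S_1(a, b) = s".  It is a relation because the existence
   of the maximum, over systems with n and m unbounded, is part of the claim. *)
Definition is_S1 (a b s : nat) : Prop := is_maximum (union_size a b) s.

(* Main.v *)
Require Import Defs.
From mathcomp Require Import all_boot all_algebra.

(** Upper bound, by induction on a.  Discard pairs until every A_i contains a
    private element p_i lying in no other A_j.  The number of remaining pairs is
    at most 'C(a + b, a), so it suffices to cover the union of the sets
    A_i \ {p_i} by a skew system with parameters (a - 1, b).  Keep only the
    indices i for which A_i \ {p_i} has an element z_i that lies in no later
    A_j; this loses no element of the union.  Crossing A_i and B_j may have
    relied on p_i alone, but replacing p_i by z_i in every later B_j repairs
    this, and keeps B_j disjoint from A_j by the choice of z_i.  Hence
    S_1(a, b) <= S_1(a - 1, b) + 'C(a + b, a).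

    The bound 'C(a + b, a) on the number of pairs comes from the triangular
    matrix \prod_(x in A_i) \prod_(z in B_j) (x - z): as a symmetric multilinear
    pairing of the powers of x with the coefficients of \prod_(z in B_j) ('X - z),
    it factors through the multisets of a exponents in {0, ..., b}.

    Lower bound: add a new point to every A of an optimal (a - 1, b) system and
    to every B of an optimal (a, b - 1) system on a disjoint ground set, and
    concatenate. *)

Set Implicit Arguments.
Unset Strict Implicit.
Unset Printing Implicit Defensive.
Import GRing.Theory Num.Theory.

(** * Rank of a matrix of products of pairings *)

Section Rank.
Local Open Scope ring_scope.

Lemma rank_prod_pairing (F : fieldType) (a b m p : nat)
    (u : 'I_m -> 'I_a -> 'I_b.+1 -> F) (c : 'I_p -> 'I_b.+1 -> F) :
  (\rank (\matrix_(i < m, j < p) \prod_(r < a) \sum_k u i r k * c j k)%R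
     <= 'C(a + b, a))%N.
Proof.
pose le_ord := relpre (@nat_of_ord b.+1) leq.
pose S := [set t : a.-tuple 'I_b.+1 | sorted leq [seq val k | k <- t]].
(* [key phi] encodes the multiset of values of [phi], on which alone the product of the
   [c j (phi r)] depends. *)
pose key (phi : {ffun 'I_a -> 'I_b.+1}) := [tuple of sort le_ord [tuple phi r | r < a]].
have keyS phi : key phi \in S.
  by rewrite inE sorted_map sort_sorted // => k l; apply: leq_total.
have prod_key j (phi : {ffun 'I_a -> 'I_b.+1}) :
    \prod_(r < a) c j (phi r) = \prod_(k <- key phi) c j k.
  by rewrite (perm_big [tuple phi r | r < a]) ?perm_sort //= big_map big_enum.
pose P : 'M[F]_(m, #|S|) := \matrix_(i, s)
  \sum_(phi | key phi == enum_val s) \prod_r u i r (phi r).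
pose Q : 'M[F]_(#|S|, p) := \matrix_(s, j) \prod_(k <- (enum_val s : a.-tuple _)) c j k.
suff ->: \matrix_(i < m, j < p) \prod_(r < a) \sum_k u i r k * c j k = P *m Q.
  by rewrite -card_sorted_tuples (leq_trans (mulmx_max_rank _ _)).
apply/matrixP=> i j; rewrite !mxE bigA_distr_bigA /=.
rewrite (partition_big key (mem S)) //= [LHS]big_enum_val /=.
apply: eq_bigr => s _; rewrite !mxE mulr_suml; apply: eq_bigr => phi /eqP <-.
by rewrite big_split prod_key.
Qed.

(** The matrix of the products of the [(q j).[p i r]] is lower triangular with nonzero diagonal, so
    its rank is [m]. *)
Lemma card_triangular_pairing (a b m : nat)
    (p : 'I_m -> 'I_a -> rat) (q : 'I_m -> {poly rat}) :
    (forall j, size (q j) <= b.+1)%N ->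
    (forall i r, (q i).[p i r] != 0) ->
    (forall i j : 'I_m, (i < j)%N -> exists r, root (q j) (p i r)) ->
  (m <= 'C(a + b, a))%N.
Proof.
move=> size_q diag upper.
have := rank_prod_pairing (fun i r (k : 'I_b.+1) => p i r ^+ k) (fun j k => (q j)`_k).
set M := \matrix_(_, _) _ => /(leq_trans _); apply.
have ME i j : M i j = \prod_(r < a) (q j).[p i r].
  rewrite mxE; apply: eq_bigr => r _; rewrite (horner_coef_wide _ (size_q j)).
  by apply: eq_bigr => k _; rewrite mulrC.
have trigM: is_trig_mx M.
  apply/is_trig_mxP => i j /upper[r /eqP q0].
  by rewrite ME (bigD1 r) //= q0 mul0r.
suff /mxrank_unit ->: M \in unitmx by [].
rewrite unitmxE unitfE det_trig //; apply/prodf_neq0 => i _.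
by rewrite ME; apply/prodf_neq0 => r _; apply: diag.
Qed.

End Rank.

(** * Skew subfamilies: number of pairs, private elements *)

Lemma ltn_enum_val (m : nat) (M : {set 'I_m}) (i j : 'I_#|M|) :
  i < j -> enum_val i < enum_val j.
Proof.
have srt : sorted (relpre val ltn) (enum M).
  rewrite /enum_mem; apply: sorted_filter; first by move=> ? ? ?; apply: ltn_trans.
  by rewrite -sorted_map -enumT val_enum_ord iota_ltn_sorted.
rewrite (enum_val_nth (enum_val i) i) (enum_val_nth (enum_val i) j).
apply: (sorted_ltn_nth _ (enum_val i) srt); rewrite ?inE -?cardE //.
by move=> ? ? ?; apply: ltn_trans.
Qed.

Section SkewOn.
Variables (n m : nat) (A B : 'I_m -> {set 'I_n}).

(** Stated relative to [M] so that discarding pairs keeps indices and their order. *)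
Definition skew_on (M : {set 'I_m}) :=
  {in M, forall i, [disjoint A i & B i]} /\
  {in M &, forall i j : 'I_m, i < j -> ~~ [disjoint A i & B j]}.

Lemma card_skew_on (a b : nat) (M : {set 'I_m}) :
    skew_on M -> {in M, forall i, #|A i| <= a} -> {in M, forall i, #|B i| <= b} ->
  #|M| <= 'C(a + b, a).
Proof.
move=> [disj skew] cardA cardB.
(* The shift by one keeps 0 out of the image of [pt]. *)
pose pt (x : 'I_n) : rat := x.+1%:R%R.
have pt_inj : injective pt.
  by move=> x y /eqP; rewrite eqr_nat eqSS => /eqP /val_inj.
(* Sets A of fewer than a elements are padded with the point 0, a root of no q j. *)
pose p (i : 'I_#|M|) (r : 'I_a) := nth 0%R [seq pt x | x <- enum (A (enum_val i))] r.
pose q (j : 'I_#|M|) := (\prod_(z <- enum (B (enum_val j))) ('X - (pt z)%:P))%R.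
have rootq j x : root (q j) x = (x \in [seq pt z | z <- enum (B (enum_val j))]).
  by rewrite /q -(big_map pt predT (fun z => 'X - z%:P)%R) root_prod_XsubC.
have rootq_pt j x : root (q j) (pt x) = (x \in B (enum_val j)).
  by rewrite rootq mem_map // mem_enum.
apply: (@card_triangular_pairing a b _ p q) => [j|i r|i j lt_ij].
- by rewrite /q size_prod_XsubC ltnS -cardE cardB ?enum_valP.
- rewrite -/(root _ _) /p.
  have [r_lt|r_ge] := ltnP r (size [seq pt x | x <- enum (A (enum_val i))]); last first.
    rewrite nth_default // rootq; apply/mapP=> -[z _ /eqP].
    by rewrite eq_sym pnatr_eq0.
  have /mapP[x] := mem_nth 0%R r_lt.
  rewrite mem_enum => xA ->; rewrite rootq_pt.
  by rewrite (disjointFr (disj _ (enum_valP i))).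
- have /pred0Pn[x /andP[/= xA xB]] :=
    skew _ _ (enum_valP i) (enum_valP j) (ltn_enum_val lt_ij).
  have lt_xa : index x (enum (A (enum_val i))) < a.
    by apply: leq_trans (cardA _ (enum_valP i)); rewrite cardE index_mem mem_enum.
  exists (Ordinal lt_xa); rewrite /p (nth_map x) ?index_mem ?mem_enum //.
  by rewrite nth_index ?mem_enum // rootq_pt.
Qed.

(** In a minimal subfamily with the same union, a set without a private element could be dropped. *)
Lemma private_cover (M : {set 'I_m}) :
  exists2 N : {set 'I_m}, N \subset M &
    \bigcup_(i in M) A i \subset \bigcup_(i in N) A i /\
    {in N, forall i, exists2 p, p \in A i & {in N, forall j, p \in A j -> j = i}}.
Proof.
pose covers (N : {set 'I_m}) := \bigcup_(i in M) A i \subset \bigcup_(i in N) A i.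
have [N /minsetP[covN minN] sNM] := minset_exists (subxx _ : covers M).
exists N => //; split=> // i Ni.
have /subsetPn[p pAi p_new] : ~~ (A i \subset \bigcup_(j in N :\ i) A j).
  apply/negP=> sAi.
  suff /minN/(_ (subD1set _ _))/setP/(_ i) : covers (N :\ i) by rewrite !inE eqxx Ni.
  apply: subset_trans covN _; apply/bigcupsP=> j Nj.
  have [-> //|ne_ji] := eqVneq j i.
  by apply: (bigcup_max j); rewrite // !inE ne_ji.
exists p => // j Nj pAj; apply: contraNeq p_new => ne_ji.
by apply/bigcupP; exists j; rewrite // !inE ne_ji.
Qed.

End SkewOn.

(** * Upper bound on the union *)

Lemma card_bigcup_skew_on (a b n m : nat) (A B : 'I_m -> {set 'I_n}) (M : {set 'I_m}) :
    skew_on A B M -> {in M, forall i, #|A i| <= a} -> {in M, forall i, #|B i| <= b} ->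
  #|\bigcup_(i in M) A i| <= 'C(a + b + 1, a) - 1.
Proof.
elim: a A B M => [|a IHa] A B M skewM cardA cardB.
  rewrite bin0 subnn leqn0 cards_eq0; apply/eqP/big1 => i Mi.
  by apply/eqP; rewrite -cards_eq0 -leqn0 cardA.
(* [x0] is the default value of [p] outside [N] and of [z] outside [I]. *)
have [->|[x0 _]] := set_0Vmem (\bigcup_(i in M) A i); first by rewrite cards0.
have [N /subsetP sNM [covN privN]] := private_cover A M.
have [disj skew] : skew_on A B N.
  by case: skewM => disj skew; split; [apply: sub_in1 disj | apply: sub_in2 skew].
have /fin_all_exists[p pP] (i : 'I_m) : exists p, i \in N ->
    p \in A i /\ {in N, forall j, p \in A j -> j = i}.
  have [/privN[p pA p_only]|_] := boolP (i \in N); first by exists p.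
  by exists x0.
pose A' i := A i :\ p i.
pose last_at i z := (z \in A' i) && [forall j in N, (i < j) ==> (z \notin A' j)].
pose I := [set i in N | [exists z, last_at i z]].
have sIN : {subset I <= N} by move=> i; rewrite inE => /andP[].
have /fin_all_exists[z zP] (i : 'I_m) : exists z, i \in I -> last_at i z.
  have [/existsP[z z_last]|no_z] := boolP [exists z, last_at i z]; first by exists z.
  by exists x0; rewrite inE (negPf no_z) andbF.
pose f (j : 'I_m) y := if [pick i in I | (i < j) && (y == p i)] is Some i then z i else y.
pose B' j := f j @: B j.
have skewI : skew_on A' B' I.
  split=> [j Ij|i j Ii Ij lt_ij].
    rewrite disjoint_sym disjoint_subset; apply/subsetP=> _ /imsetP[y By ->].
    rewrite !inE negb_and /f; case: pickP => [i|_]; last first.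
      by rewrite (disjointFl (disj _ (sIN _ Ij)) By) orbT.
    case/and3P=> Ii lt_ij _; have /andP[_ /forall_inP/(_ j (sIN _ Ij))] := zP _ Ii.
    by rewrite lt_ij !inE negb_and.
  have /pred0Pn[x /andP[/= xA xB]] := skew _ _ (sIN _ Ii) (sIN _ Ij) lt_ij.
  apply/pred0Pn; exists (f j x); rewrite /= imset_f // andbT /f.
  (* If [x] is [p k], then [x] in [A i] forces [k = i], and [x] moves to [z i], in [A' i]. Otherwise
     [x] differs from [p i] and stays in place. *)
  case: pickP => [k /and3P[Ik _ /eqP x_pk]|noneP].
    have [_ only_k] := pP k (sIN _ Ik).
    rewrite -(only_k i) ?sIN // -?x_pk //.
    by have /andP[] := zP _ Ii.
  rewrite !inE xA andbT; have := noneP i; rewrite Ii lt_ij /= => /negbT; exact.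
have cardA' : {in I, forall i, #|A' i| <= a}.
  move=> i /sIN Ni; have [pA _] := pP i Ni.
  by have := cardA i (sNM _ Ni); rewrite (cardsD1 (p i)) pA.
have cardB' : {in I, forall i, #|B' i| <= b}.
  by move=> i /sIN/sNM/cardB; apply: leq_trans; apply: leq_imset_card.
have cov : \bigcup_(i in M) A i \subset (\bigcup_(i in I) A' i) :|: p @: N.
  apply: subset_trans covN _; apply/bigcupsP=> i Ni; apply/subsetP=> x xA.
  rewrite inE; have [->|ne_x] := eqVneq x (p i); first by rewrite imset_f ?orbT.
  have Pi : [pred k | (k \in N) && (x \in A' k)] i by rewrite /= Ni !inE ne_x.
  (* The last [j] in [N] with [x] in [A' j] belongs to [I], witnessed by [x]. *)
  apply/orP; left; case: (arg_maxnP (@nat_of_ord m) Pi) => j /andP[Nj xj] maxj.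
  apply/bigcupP; exists j => //; rewrite inE Nj; apply/existsP; exists x.
  rewrite /last_at xj; apply/forall_inP=> k Nk; apply/implyP; rewrite ltnNge.
  by apply: contra => xk; apply: maxj; rewrite /= Nk.
have cardN : #|p @: N| <= 'C(a.+1 + b, a.+1).
  apply: leq_trans (leq_imset_card _ _) _.
  by apply: (@card_skew_on n m A B) => // i /sNM; [apply: cardA | apply: cardB].
apply: leq_trans (subset_leq_card cov) _; apply: leq_trans (leq_card_setU _ _) _.
apply: leq_trans (leq_add (IHa _ _ _ skewI cardA' cardB') cardN) _.
by rewrite !addn1 addSn addnC addnBA ?bin_gt0 -?binS // leqW ?leq_addr.
Qed.

(** * Construction for the lower bound *)

Definition bounded_pair (T : finType) (a b : nat) (P : {set T} * {set T}) :=
  [&& [disjoint P.1 & P.2], #|P.1| <= a & #|P.2| <= b].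

Definition crosses (T : finType) (P Q : {set T} * {set T}) := ~~ [disjoint P.1 & Q.2].

(** The sets A cover [T], so the union has size [#|T|]; an arbitrary ground type lets systems be
    joined over a sum type. *)
Definition covering_system (T : finType) (a b : nat) (s : seq ({set T} * {set T})) :=
  [/\ s != [::], all (bounded_pair a b) s, pairwise (@crosses T) s
    & forall x : T, has (fun P : {set T} * {set T} => x \in P.1) s].

Lemma disjoint_setU1 (T : finType) (x : T) (A B : {set T}) :
  [disjoint x |: A & B] = (x \notin B) && [disjoint A & B].
Proof. by rewrite -!setI_eq0 setIUl setU_eq0 !setI_eq0 disjoints1. Qed.

Section Join.
Variables T1 T2 : finType.
Let inl_some (x : T1) : option (T1 + T2) := Some (inl x).
Let inr_some (x : T2) : option (T1 + T2) := Some (inr x).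

(** [None] is the new point; it makes every left pair cross every right pair. *)
Definition add_left (P : {set T1} * {set T1}) :=
  (None |: inl_some @: P.1, inl_some @: P.2).
Definition add_right (P : {set T2} * {set T2}) :=
  (inr_some @: P.1, None |: inr_some @: P.2).

Let inl_inj : injective inl_some. Proof. by move=> ? ? []. Qed.
Let inr_inj : injective inr_some. Proof. by move=> ? ? []. Qed.

Let None_inl (A : {set T1}) : None \notin inl_some @: A.
Proof. by apply/imsetP=> -[]. Qed.

Let None_inr (A : {set T2}) : None \notin inr_some @: A.
Proof. by apply/imsetP=> -[]. Qed.

Lemma join_covering a b s1 s2 :
    covering_system a b.+1 s1 -> covering_system a.+1 b s2 ->
  covering_system a.+1 b.+1 (map add_left s1 ++ map add_right s2).
Proof.
move=> [n1 ok1 pw1 cov1] [n2 ok2 pw2 cov2]; split.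
- by case: s1 n1 {ok1 pw1 cov1}.
- rewrite all_cat !all_map; apply/andP; split.
    apply: sub_all ok1 => P /and3P[d c1 c2]; apply/and3P; split=> /=.
    + by rewrite disjoint_setU1 None_inl imset_disjoint.
    + by rewrite cardsU1 None_inl card_imset.
    + by rewrite card_imset.
  apply: sub_all ok2 => P /and3P[d c1 c2]; apply/and3P; split=> /=.
  + by rewrite disjoint_sym disjoint_setU1 None_inr disjoint_sym imset_disjoint.
  + by rewrite card_imset.
  + by rewrite cardsU1 None_inr card_imset.
- rewrite pairwise_cat !pairwise_map; apply/and3P; split.
  + apply/allrelP=> _ _ /mapP[P _ ->] /mapP[Q _ ->].
    by apply/pred0Pn; exists None; rewrite /= !inE.
  + apply: sub_pairwise pw1 => P Q /pred0Pn[x /andP[/= xP xQ]].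
    by apply/pred0Pn; exists (inl_some x); rewrite /= in_setU1 !mem_imset ?xP.
  + apply: sub_pairwise pw2 => P Q /pred0Pn[x /andP[/= xP xQ]].
    by apply/pred0Pn; exists (inr_some x); rewrite /= in_setU1 !mem_imset ?xP.
- move=> x; rewrite has_cat !has_map; case: x => [[x|x]|].
  + by apply/orP; left; apply: sub_has (cov1 x) => P xP; rewrite /= in_setU1 mem_imset.
  + by apply/orP; right; apply: sub_has (cov2 x) => P xP; rewrite /= mem_imset.
  + by case: s1 n1 {ok1 pw1 cov1} => //= P s _; rewrite setU11.
Qed.

End Join.

Lemma covering_system_exists (a b : nat) :
  exists (T : finType) (s : seq ({set T} * {set T})),
    covering_system a b s /\ #|T| = 'C(a + b + 1, a) - 1.
Proof.
elim: a b => [|a IHa] b.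
  exists void, [:: (set0, set0)]; rewrite card_void bin0; split=> //.
  split=> //=.
  by rewrite andbT /bounded_pair -setI_eq0 setI0 eqxx cards0.
elim: b => [|b [T2 [s2 [cov2 card2]]]].
  exists 'I_a.+1, [:: (setT, set0)]; rewrite card_ord addn0 addn1 binSn subn1.
  split=> //; split=> //= [|x]; last by rewrite inE.
  by rewrite andbT /bounded_pair -setI_eq0 setI0 eqxx cards0 cardsT card_ord leqnn.
have [T1 [s1 [cov1 card1]]] := IHa b.+1.
exists (option (T1 + T2)), (map (@add_left T1 T2) s1 ++ map (@add_right T1 T2) s2).
split; first exact: join_covering.
rewrite card_option card_sum card1 card2 !addn1 !addSn !addnS [in RHS]binS.
(* Positivity makes the truncated subtractions exact; the point [None] makes up for one of the two
   units subtracted. *)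
have : 0 < 'C((a + b).+2, a.+1) by rewrite bin_gt0 ltnS leqW ?leq_addr.
have : 0 < 'C((a + b).+2, a) by rewrite bin_gt0 !leqW ?leq_addr.
move: 'C(_, a) 'C(_, a.+1) => [|x] [|y] // _ _.
by rewrite !subn1 addnS /= addSn addnC.
Qed.

(** * Transfer of both bounds to systems on ['I_n] *)

Theorem theorem1p3 (a b : nat) : is_S1 a b ('C(a + b + 1, a) - 1).
Proof.
split; last first.
  move=> k [n [m [A [B [_ [disj skew] card_le ->]]]]].
  have -> : \bigcup_(i < m) A i = \bigcup_(i in [set: 'I_m]) A i.
    by apply: eq_bigl => i; rewrite inE.
  apply: (@card_bigcup_skew_on a b n m A B).
  - split=> [i _|i j _ _ /skew]; first by rewrite -setI_eq0 disj.
    by move/eqP; rewrite setI_eq0.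
  - by move=> i _; have [] := card_le i.
  - by move=> i _; have [] := card_le i.
(* For [a = 0] the covering system may live on an empty type, but [n] must be positive; the empty
   family on one point serves instead. *)
case: a => [|a].
  rewrite bin0 subnn; exists 1, 0, (fun=> set0), (fun=> set0).
  by split=> //; [split; case | case | rewrite big_ord0 cards0].
have [T [s [[_ /allP ok pw cov] cardT]]] := covering_system_exists a.+1 b.
pose im (A : {set T}) := enum_rank @: A.
pose P (i : 'I_(size s)) := tnth (in_tuple s) i.
exists #|T|, (size s), (fun i => im (P i).1), (fun i => im (P i).2).
have okP i : bounded_pair a.+1 b (P i) by apply: ok; apply: mem_tnth.
have inj_rank := @enum_rank_inj T.
split.
- rewrite cardT subn_gt0 addn1 addSn binS.
  by apply: (@leq_add 1 1); rewrite bin_gt0 ?ltnS ?leqW ?leq_addr.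
- split=> [i|i j lt_ij].
    apply/eqP; rewrite setI_eq0 imset_disjoint //.
    by have /and3P[] := okP i.
  apply/eqP; rewrite setI_eq0 imset_disjoint //.
  rewrite /P !(tnth_nth (set0, set0)).
  by move/(pairwiseP (set0, set0)): pw; apply; rewrite ?inE.
- by move=> i; rewrite !card_imset //; have /and3P[] := okP i.
suff -> : \bigcup_(i < size s) im (P i).1 = [set: 'I_#|T|].
  by rewrite cardsT card_ord.
apply/setP=> y; rewrite inE; apply/bigcupP.
have /(has_nthP (set0, set0))[i lt_i xP] := cov (enum_val y).
exists (Ordinal lt_i) => //; rewrite -[y]enum_valK imset_f //.
by rewrite /P (tnth_nth (set0, set0)).
Qed.
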